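(* Let $Y$ be a (lower) semilattice and $\{S_\alpha\mid\alpha\in Y\}$ a family of disjoint generalized left semi-braces. For each pair $\alpha,\beta$ of elements of $Y$ such that $\alpha\geq\beta$, let $\phi_{\alpha,\beta}:S_\alpha\to S_\beta$ be a homomorphism of generalized left semi-braces such that 1. $\phi_{\alpha,\alpha}$ is the identical automorphism of $S_\alpha$, for every $\alpha\in Y$; 2. $\phi_{\beta,\gamma}\phi_{\alpha,\beta}=\phi_{\alpha,\gamma}$, for all $\alpha,\beta,\gamma\in Y$ such that $\alpha\geq\beta\geq\gamma$. Then $S=\bigcup\{S_\alpha\mid\alpha\in Y\}$ endowed with the addition and the multiplication defined by $$a+b=\phi_{\alpha,\alpha\beta}(a)+\phi_{\beta,\alpha\beta}(b),\qquad a\circ b=\phi_{\alpha,\alpha\beta}(a)\circ\phi_{\beta,\alpha\beta}(b),$$ for any $a\in S_\alpha$ and $b\in S_\beta$ (and any $\alpha,\beta\in Y$), is a generalized left semi-brace.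
   Context: A semigroup $(S,\circ)$ is completely regular if for every $a\in S$ there exists a (unique) element $a^-\in S$ such that $a=a\circ a^-\circ a$, $a^-=a^-\circ a\circ a^-$ and $a\circ a^-=a^-\circ a$. A generalized left semi-brace is a triple $(S,+,\circ)$ where $(S,+)$ is a semigroup (not necessarily commutative), $(S,\circ)$ is a completely regular semigroup, and $$a\circ(b+c)=a\circ b+a\circ(a^-+c)\qquad\text{for all } a,b,c\in S,$$ where $\circ$ takes precedence over $+$. A homomorphism of generalized left semi-braces is a map preserving both operations $+$ and $\circ$. A (lower) semilattice $Y$ is a commutative semigroup, written multiplicatively, in which every element is idempotent, ordered by $\alpha\geq\beta$ if and only if $\alpha\beta=\beta$; thus $\alpha\beta$ is the meet of $\alpha$ and $\beta$. *)

(* Defs.v *)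
From mathcomp Require Import all_boot.

Set Implicit Arguments.
Unset Strict Implicit.
Unset Printing Implicit Defensive.

(* MathComp's meetSemilatticeType is not used: it would restrict the index to
   a choiceType with a boolean order. *)
Record semilattice := Semilattice {
  sl_sort :> Type;
  sl_mul : sl_sort -> sl_sort -> sl_sort;
  sl_mulA : associative sl_mul;
  sl_mulC : commutative sl_mul;
  sl_mulxx : idempotent_op sl_mul
}.

Definition sl_ge (Y : semilattice) (alpha beta : Y) : Prop :=
  sl_mul alpha beta = beta.

Lemma sl_ge_mull (Y : semilattice) (alpha beta : Y) :
  sl_ge alpha (sl_mul alpha beta).
Proof. by rewrite /sl_ge sl_mulA sl_mulxx. Qed.

Lemma sl_ge_mulr (Y : semilattice) (alpha beta : Y) :
  sl_ge beta (sl_mul alpha beta).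
Proof. by rewrite sl_mulC; exact: sl_ge_mull. Qed.

(* [is_cr_inverse mul a x] says that x is the element a^- of the semigroup
   (S, mul). *)
Definition is_cr_inverse (S : Type) (mul : S -> S -> S) (a x : S) : Prop :=
  [/\ a = mul (mul a x) a, x = mul (mul x a) x & mul a x = mul x a].

Lemma cr_inverse_unique (S : Type) (mul : S -> S -> S) (a x y : S) :
  associative mul -> is_cr_inverse mul a x -> is_cr_inverse mul a y -> x = y.
Proof.
move=> mulA [axa xax axC] [aya yay ayC].
have exy : mul a x = mul a y.
  transitivity (mul (mul a y) (mul a x)); first by rewrite mulA -aya.
  by rewrite ayC axC -mulA [mul a (mul x a)]mulA -axa.
by rewrite xax -axC exy ayC -mulA exy mulA -yay.
Qed.

Definition completely_regular (S : Type) (mul : S -> S -> S) : Prop :=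
  associative mul /\ forall a, exists x, is_cr_inverse mul a x.

(* By cr_inverse_unique, the variable a' of the last clause stands for the
   element a^- . *)
Definition is_gen_left_semi_brace (S : Type) (add mul : S -> S -> S) : Prop :=
  [/\ associative add,
      completely_regular mul
    & forall a a', is_cr_inverse mul a a' ->
        forall b c, mul a (add b c) = add (mul a b) (mul a (add a' c))].

Record gen_left_semi_brace := GenLeftSemiBrace {
  sb_sort :> Type;
  sb_add : sb_sort -> sb_sort -> sb_sort;
  sb_mul : sb_sort -> sb_sort -> sb_sort;
  sb_axioms : is_gen_left_semi_brace sb_add sb_mul
}.

Definition is_semi_brace_hom (A B : gen_left_semi_brace) (f : A -> B) : Prop :=
  {morph f : x y / sb_add x y >-> sb_add x y} /\
  {morph f : x y / sb_mul x y >-> sb_mul x y}.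

Section StrongSemilattice.

Variables (Y : semilattice) (S : Y -> gen_left_semi_brace).
Variable phi : forall alpha beta : Y, sl_ge alpha beta -> S alpha -> S beta.

(* The disjoint union of the S alpha. *)
Definition strong_union : Type := {alpha : Y & S alpha}.

Definition strong_add (u v : strong_union) : strong_union :=
  let: existT alpha a := u in
  let: existT beta b := v in
  existT (fun gamma => sb_sort (S gamma)) (sl_mul alpha beta)
    (sb_add (phi (sl_ge_mull alpha beta) a) (phi (sl_ge_mulr alpha beta) b)).

Definition strong_mul (u v : strong_union) : strong_union :=
  let: existT alpha a := u in
  let: existT beta b := v in
  existT (fun gamma => sb_sort (S gamma)) (sl_mul alpha beta)
    (sb_mul (phi (sl_ge_mull alpha beta) a) (phi (sl_ge_mulr alpha beta) b)).

End StrongSemilattice.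

(* Main.v *)
Require Import Defs.
From mathcomp Require Import all_boot.

(** All elements involved in an identity between terms of the union can be
    transported, along the maps phi, to a single component lying below all of
    them.  Since transport is functorial and compatible with the operations,
    transporting a term amounts to transporting its variables
    ([transport_op]).  An identity in the union thus splits into an identity
    between indices, which holds in every semilattice, and the same identity
    between transported variables inside one component
    ([union_eq_transport]).  Both associativity laws follow at once
    ([union_opA]).

    The remaining point is the inverse.  An inverse of a in its own component
    is still one in the union, because the component is a subalgebra of the union
    ([union_op_same], [union_cr_inverse]); this gives complete regularity.
    By uniqueness it is then the only inverse of a in the union, and its
    transports are inverses of the transports of a, so that the brace identity
    also reduces to the one in a component. *)

Lemma sl_ge_trans (Y : semilattice) (alpha beta gamma : Y) :
  sl_ge alpha beta -> sl_ge beta gamma -> sl_ge alpha gamma.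
Proof. by rewrite /sl_ge => hab <-; rewrite sl_mulA hab. Qed.

Lemma morph_cr_inverse (A B : Type) (mulA : A -> A -> A) (mulB : B -> B -> B)
    (f : A -> B) (a x : A) :
  {morph f : u v / mulA u v >-> mulB u v} ->
  is_cr_inverse mulA a x -> is_cr_inverse mulB (f a) (f x).
Proof. by move=> fM [axa xax axC]; split; rewrite -!fM -?axa -?xax -?axC. Qed.

Section DirectedSystem.

Context {Y : semilattice} {T : Y -> Type}.
Context {phi : forall alpha beta : Y, sl_ge alpha beta -> T alpha -> T beta}.

Hypothesis phi_id : forall (alpha : Y) (h : sl_ge alpha alpha) (a : T alpha),
  phi alpha alpha h a = a.
Hypothesis phi_comp : forall (alpha beta gamma : Y) (hab : sl_ge alpha beta)
  (hbc : sl_ge beta gamma) (hac : sl_ge alpha gamma) (a : T alpha),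
  phi beta gamma hbc (phi alpha beta hab a) = phi alpha gamma hac a.

(** The order is a proposition that need not have unique proofs, so phi could
    depend on the chosen proof; composing with an identity rules this out. *)
Lemma phi_irrelevance (alpha beta : Y) (h h' : sl_ge alpha beta) (a : T alpha) :
  phi alpha beta h a = phi alpha beta h' a.
Proof.
by rewrite -[in LHS](phi_id alpha (sl_mulxx alpha) a) (phi_comp _ _ _ _ _ h').
Qed.

(** Quantifying over all lower bounds gamma, instead of casting along
    alpha = beta, keeps dependent rewriting out of the algebraic
    computations. *)
Lemma union_eq_transport (alpha beta : Y) (a : T alpha) (b : T beta) :
  alpha = beta ->
  (forall gamma (ha : sl_ge alpha gamma) (hb : sl_ge beta gamma),
     phi alpha gamma ha a = phi beta gamma hb b) ->
  existT T alpha a = existT T beta b.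
Proof.
move=> eq_ab; case: beta / eq_ab b => b eq_phi; congr existT.
by have := eq_phi alpha (sl_mulxx alpha) (sl_mulxx alpha); rewrite !phi_id.
Qed.

Section Operation.

Variable op : forall alpha : Y, T alpha -> T alpha -> T alpha.
Hypothesis phi_op : forall (alpha beta : Y) (h : sl_ge alpha beta),
  {morph phi alpha beta h : x y / op alpha x y >-> op beta x y}.

(** The common pattern of [strong_add] and [strong_mul], to which it is
    convertible when [op] is the addition or the multiplication. *)
Definition union_op (u v : {alpha : Y & T alpha}) : {alpha : Y & T alpha} :=
  let: existT alpha a := u in
  let: existT beta b := v in
  existT T (sl_mul alpha beta)
    (op _ (phi _ _ (sl_ge_mull alpha beta) a)
          (phi _ _ (sl_ge_mulr alpha beta) b)).

Lemma transport_op (alpha beta gamma : Y) (h : sl_ge (sl_mul alpha beta) gamma)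
    (a : T alpha) (b : T beta) :
  phi _ _ h (op _ (phi _ _ (sl_ge_mull alpha beta) a)
                  (phi _ _ (sl_ge_mulr alpha beta) b)) =
  op _ (phi _ _ (sl_ge_trans _ _ _ _ (sl_ge_mull alpha beta) h) a)
       (phi _ _ (sl_ge_trans _ _ _ _ (sl_ge_mulr alpha beta) h) b).
Proof. by rewrite phi_op; congr op; exact: phi_comp. Qed.

Lemma union_opA : (forall alpha, associative (op alpha)) -> associative union_op.
Proof.
move=> opA [alpha a] [beta b] [gamma c].
apply: union_eq_transport => [|delta hl hr]; first exact: sl_mulA.
rewrite !transport_op opA.
by congr (op _ (op _ _ _) _); exact: phi_irrelevance.
Qed.

(** Each component is a subalgebra of the union: the transports involved go
    from alpha to alpha alpha = alpha, hence are identities. *)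
Lemma union_op_same (alpha : Y) (a b : T alpha) :
  union_op (existT T alpha a) (existT T alpha b) = existT T alpha (op _ a b).
Proof.
apply: union_eq_transport => [|gamma hl hr]; first exact: sl_mulxx.
by rewrite transport_op phi_op; congr op; exact: phi_irrelevance.
Qed.

Lemma union_cr_inverse (alpha : Y) (a x : T alpha) :
  is_cr_inverse (op alpha) a x ->
  is_cr_inverse union_op (existT T alpha a) (existT T alpha x).
Proof.
by apply: morph_cr_inverse => b c; rewrite union_op_same.
Qed.

Lemma union_completely_regular :
  (forall alpha, completely_regular (op alpha)) -> completely_regular union_op.
Proof.
move=> op_cr; split=> [|[alpha a]].
  by apply: union_opA => alpha; case: (op_cr alpha).
have [_ /(_ a)[x ax]] := op_cr alpha.
by exists (existT T alpha x); exact: union_cr_inverse.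
Qed.

End Operation.

End DirectedSystem.

Theorem proposition10 (Y : semilattice) (S : Y -> gen_left_semi_brace)
  (phi : forall alpha beta : Y, sl_ge alpha beta -> S alpha -> S beta)
  (phi_hom : forall (alpha beta : Y) (h : sl_ge alpha beta),
    is_semi_brace_hom (phi alpha beta h))
  (phi_id : forall (alpha : Y) (h : sl_ge alpha alpha) (a : S alpha),
    phi alpha alpha h a = a)
  (phi_comp : forall (alpha beta gamma : Y) (hab : sl_ge alpha beta)
    (hbc : sl_ge beta gamma) (hac : sl_ge alpha gamma) (a : S alpha),
    phi beta gamma hbc (phi alpha beta hab a) = phi alpha gamma hac a) :
  is_gen_left_semi_brace (strong_add phi) (strong_mul phi).
Proof.
pose add alpha := @sb_add (S alpha); pose mul alpha := @sb_mul (S alpha).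
have phiD alpha beta h : {morph phi alpha beta h : x y / add _ x y >-> add _ x y}.
  by case: (phi_hom alpha beta h).
have phiM alpha beta h : {morph phi alpha beta h : x y / mul _ x y >-> mul _ x y}.
  by case: (phi_hom alpha beta h).
have mul_cr alpha : completely_regular (mul alpha).
  by case: (sb_axioms (S alpha)).
change (is_gen_left_semi_brace (union_op (phi := phi) add)
                               (union_op (phi := phi) mul)).
have union_mul_cr := union_completely_regular phi_id phi_comp mul phiM mul_cr.
split=> //.
  by apply: union_opA => // alpha; case: (sb_axioms (S alpha)).
move=> [alpha a] u' au' [beta b] [gamma c].
have [_ /(_ a)[x ax]] := mul_cr alpha.
(* The given inverse of a, which could a priori lie in another component, is
   the inverse taken in the component of a. *)
have -> : u' = existT (fun gamma => sb_sort (S gamma)) alpha x.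
  apply: (cr_inverse_unique union_mul_cr.1 au').
  exact: (union_cr_inverse phi_id phi_comp).
apply: (union_eq_transport phi_id) => [|delta hl hr].
  (* The index alpha occurs once on the left of the brace identity and three
     times on the right; idempotence absorbs the two extra occurrences. *)
  rewrite [sl_mul alpha (sl_mul alpha gamma)]sl_mulA sl_mulxx.
  rewrite [sl_mul alpha beta]sl_mulC -sl_mulA.
  rewrite [sl_mul alpha (sl_mul alpha gamma)]sl_mulA sl_mulxx.
  by rewrite sl_mulA [sl_mul alpha beta]sl_mulC sl_mulA.
rewrite !(transport_op phi_comp add phiD, transport_op phi_comp mul phiM).
have [_ _ brace] := sb_axioms (S delta).
rewrite /add /mul (brace _ _ (morph_cr_inverse _ _ _ _ _ _ _ (phiM _ _ _) ax)).
by congr (sb_add (sb_mul _ _) (sb_mul _ (sb_add _ _)));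
  apply: phi_irrelevance.
Qed.
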